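(* Let $q\geqslant 3$ be an integer and let $\chi$ be a completely even primitive character mod $q$. Then $$\mathcal{K}(\chi,q)=q\,\varphi^2(q)\sum_{\substack{y \bmod q\\ y^2\equiv 1 \,(\bmod q)}}\chi(y).$$ Moreover, $\mathcal{K}(\chi,q)=0$ if $8\mid q$, and if $8\nmid q$ then $$q\,\varphi^2(q)\leqslant \mathcal{K}(\chi,q)\leqslant q\,\varphi^2(q)\,2^{\omega(q)}.$$
   Context: For a positive integer $q$ and a Dirichlet character $\chi$ mod $q$, define $$\mathcal{K}(\chi,q)=\sum_{m \bmod q}\ \sum_{n \bmod q}\Bigl|\sum_{\substack{a \bmod q\\ \gcd(a,q)=1}}\chi(ma+n\overline{a})\Bigr|^2,$$ where $\overline{a}$ is the multiplicative inverse of $a$ modulo $q$, and $m,n$ each run over a complete residue system mod $q$. Here $\varphi$ is Euler's function, $\varphi^2(q)=(\varphi(q))^2$, and $\omega(q)$ is the number of distinct prime divisors of $q$. Completely even characters: let $q=\prod_{1\leqslant i\leqslant s}p_i^{\alpha_i}$ be the canonical prime factorization of $q$, and write $\chi=\prod_{1\leqslant i\leqslant s}\chi_i$ with $\chi_i$ a character mod $p_i^{\alpha_i}$ for each $i$. The character $\chi$ is called completely even if $\chi_i(-1)=1$ for every $i$. *)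

(* Defs.v *)
From HB Require Import structures.
From mathcomp Require Import all_boot all_order all_algebra.
From mathcomp Require Import complex.
From mathcomp Require Import reals.

Set Implicit Arguments.
Unset Strict Implicit.
Unset Printing Implicit Defensive.

Import Order.TTheory GRing.Theory Num.Theory.

Local Open Scope ring_scope.

(* Characters mod [q] are [q]-periodic functions on the integers, rather than
   functions on ['Z_q], because ['Z_1] is the two-element ring and the modulus
   [1] has to be available in [primitive_character]. *)
Definition dirichlet_character (C : numClosedFieldType) (q : nat)
    (chi : int -> C) : Prop :=
  [/\ forall n : int, chi (n + q%:Z) = chi n,
      chi 1 = 1,
      forall m n : int, chi (m * n) = chi m * chi n
    & forall n : int, (chi n != 0) = coprimez n q%:Z].

Definition induced_from (C : numClosedFieldType) (q : nat) (chi : int -> C)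
    (d : nat) : Prop :=
  exists psi : int -> C, dirichlet_character d psi /\
    forall n : int, coprimez n q%:Z -> chi n = psi n.

Definition primitive_character (C : numClosedFieldType) (q : nat)
    (chi : int -> C) : Prop :=
  dirichlet_character q chi /\
  forall d : nat, (d %| q)%N -> (d < q)%N -> ~ induced_from q chi d.

(* The local components [chi_ p] are uniquely determined by [chi], so asking
   for the existence of a factorization with even components is the same as
   asking that the components of the factorization be even. *)
Definition completely_even (C : numClosedFieldType) (q : nat)
    (chi : int -> C) : Prop :=
  exists chi_ : nat -> int -> C,
    [/\ forall p : nat, p \in primes q ->
          dirichlet_character (p ^ logn p q)%N (chi_ p),
        forall n : int, chi n = \prod_(p <- primes q) chi_ p n
      & forall p : nat, p \in primes q -> chi_ p (-1) = 1].

(* A Bezout coefficient: [modinv q a * a + v * q = gcd (a, q)] for some [v],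
   so this is an inverse of [a] modulo [q] when [a] is coprime to [q]. *)
Definition modinv (q : nat) (a : int) : int := (egcdz a q%:Z).1.

(* The value lies in [C]; on [R[i]], [x <= y] means that [y - x] is a
   nonnegative real number. *)
Definition Ksum (C : numClosedFieldType) (q : nat) (chi : int -> C) : C :=
  \sum_(m < q) \sum_(n < q)
    `| \sum_(a < q | coprime a q)
         chi (m%:Z * a%:Z + n%:Z * modinv q a%:Z) | ^+ 2.

Definition omega (q : nat) : nat := size (primes q).

(* Main.v *)
Require Import Defs.
From HB Require Import structures.
From mathcomp Require Import all_boot all_order all_algebra.
From mathcomp Require Import complex ring zify.
From mathcomp Require Import boolp reals.

Set Implicit Arguments.
Unset Strict Implicit.
Unset Printing Implicit Defensive.

Import Order.TTheory GRing.Theory Num.Theory.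

Local Open Scope ring_scope.

(* Expand the square in [Ksum].  For units a, b, the substitution k = n + m b^2
   turns the sum over m, n into a correlation of chi along the arithmetic
   progressions k + m (a^2 - b^2).  Primitivity gives a unit c = 1 modulo
   gcd (a^2 - b^2, q) with chi c <> 1; multiplication by c permutes each
   progression, so the correlation vanishes unless a^2 = b^2, and putting
   y = b / a leaves the sum of chi over the square roots y of 1.
     If 8 | q, primitivity with d = q / 2 gives such a c with c^2 = 1, so that sum
   is zero.  If q is even but 8 does not divide q, the 2-component of chi is even
   modulo 2 or 4, hence trivial, and chi is induced from the odd part of q.  If q is
   odd, each square root of 1 is 1 or -1 modulo each prime power, so chi is 1 on it. *)

(** * Multiplicative characters of a finite commutative ring and their Kloosterman-type sum *)

Section FiniteRingCharacter.
Variables (R : finComUnitRingType) (C : numClosedFieldType) (f : R -> C).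
Hypothesis f1 : f 1 = 1.
Hypothesis fM : {morph f : x y / x * y}.
Hypothesis f_neq0 : forall x, (f x != 0) = (x \is a GRing.unit).

(** Multiplication by [x] permutes the units, so the product [P] of all [|f u|] equals [P] times a
    positive power of [|f x|]. *)
Lemma norm_char_unit (x : R) : x \is a GRing.unit -> `|f x| = 1.
Proof.
move=> Ux.
pose P := \prod_(u : R | u \is a GRing.unit) `|f u|.
have P0 : P != 0.
  by apply/prodf_neq0 => u Uu; rewrite normr_eq0 f_neq0.
have PE : P = `|f x| ^+ #|[pred u : R | u \is a GRing.unit]| * P.
  rewrite {1}/P (reindex_inj (mulrI Ux)) /=.
  under eq_bigl => u do rewrite unitrMr //.
  under eq_bigr => u _ do rewrite fM normrM.
  by rewrite big_split /= prodr_const.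
have /eqP : `|f x| ^+ #|[pred u : R | u \is a GRing.unit]| = 1.
  by apply: (mulIf P0); rewrite -PE mul1r.
rewrite pexpr_eq1 ?normr_ge0 //; first by move/eqP.
by apply/card_gt0P; exists 1; rewrite inE unitr1.
Qed.

Lemma conj_char_unit (x : R) : x \is a GRing.unit -> (f x)^* = f x^-1.
Proof.
move=> Ux; have fx0 : f x != 0 by rewrite f_neq0.
apply: (mulfI fx0).
by rewrite -normCK norm_char_unit // expr1n -fM divrr.
Qed.

Lemma sqr_norm_char (x : R) : f x * (f x)^* = (x \is a GRing.unit)%:R.
Proof.
rewrite -normCK; have [Ux|nUx] := boolP (x \is a GRing.unit).
  by rewrite norm_char_unit // expr1n.
by move: nUx; rewrite -f_neq0 negbK => /eqP ->; rewrite normr0 expr0n.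
Qed.

(** Primitivity without moduli: [f] is nontrivial on the units congruent to 1 modulo any nonzero
    principal ideal. *)
Definition ring_primitive : Prop :=
  forall d : R, d != 0 ->
    exists e : R, 1 + d * e \is a GRing.unit /\ f (1 + d * e) != 1.

Hypothesis f_prim : ring_primitive.

Lemma sum_char_progression (k d : R) : d != 0 -> \sum_m f (k + m * d) = 0.
Proof.
move=> /f_prim[e [Uc fc1]]; set c := 1 + d * e in Uc fc1.
have /eqP : f c * (\sum_m f (k + m * d)) = \sum_m f (k + m * d).
  (* The two reindexings realise [c * (k + m * d) = k + (e * k + c * m) * d]. *)
  rewrite mulr_sumr [RHS](reindex_inj (addrI (e * k))) /=.
  rewrite [RHS](reindex_inj (mulrI Uc)) /=.
  by apply: eq_bigr => m _; rewrite -fM; congr f; rewrite /c; ring.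
rewrite -subr_eq0 -{2}[\sum_m _]mul1r -mulrBl mulf_eq0 subr_eq0.
by rewrite (negPf fc1) => /eqP.
Qed.

Lemma char_correlation (d : R) :
  \sum_k \sum_m f (k + m * d) * (f k)^* =
  (d == 0)%:R * (#|R|%:R * #|[pred u : R | u \is a GRing.unit]|%:R).
Proof.
have [->|d0] := eqVneq d 0; last first.
  by rewrite mul0r big1 // => k _; rewrite -mulr_suml sum_char_progression ?mul0r.
(* For [d = 0] the summand is free of [m] and is the indicator of the units. *)
rewrite mul1r mulr_natl -[X in _ *+ X]/(#|xpredT|) -sumr_const exchange_big /=.
apply: eq_bigr => m _.
under eq_bigr => k _ do rewrite mulr0 addr0 sqr_norm_char.
by rewrite -sum1_card natr_sum [RHS]big_mkcond; apply: eq_bigr => k _; case: ifP.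
Qed.

Lemma sum_sqr_norm_kloosterman :
  \sum_m \sum_n `| \sum_(a | a \is a GRing.unit) f (m * a + n * a^-1) | ^+ 2 =
  #|R|%:R * #|[pred u : R | u \is a GRing.unit]|%:R ^+ 2
    * \sum_(y | y ^+ 2 == 1) f y.
Proof.
set N : C := #|[pred u : R | u \is a GRing.unit]|%:R.
transitivity (\sum_(a : R | a \is a GRing.unit) \sum_(b : R | b \is a GRing.unit)
    \sum_m \sum_n f (m * a + n * a^-1) * (f (m * b + n * b^-1))^*).
  rewrite exchange_big; under eq_bigr => n _.
    under eq_bigr => m _ do rewrite normCK rmorph_sum big_distrlr /=.
    rewrite exchange_big /=; under eq_bigr => a _ do rewrite exchange_big /=.
    over.
  rewrite exchange_big /=; apply: eq_bigr => a _.
  rewrite exchange_big /=; apply: eq_bigr => b _.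
  by rewrite exchange_big.
transitivity (\sum_(a : R | a \is a GRing.unit) \sum_(b : R | b \is a GRing.unit)
    f (a^-1 * b) * ((a ^+ 2 == b ^+ 2)%:R * (#|R|%:R * N))).
  apply: eq_bigr => a Ua; apply: eq_bigr => b Ub.
  rewrite -subr_eq0 -char_correlation [in RHS]exchange_big /= mulr_sumr.
  apply: eq_bigr => m _; rewrite (reindex_inj (addrI (- (m * b ^+ 2)))) /=.
  rewrite mulr_sumr; apply: eq_bigr => k _.
  (* Pulling out [u^-1] leaves an argument with [n] bare, so that the shift of [n] by [m * b ^+ 2]
     acts on both factors. *)
  have split_inv (u n : R) : u \is a GRing.unit ->
      f (m * u + n * u^-1) = f u^-1 * f (m * u ^+ 2 + n).
    move=> Uu; rewrite -fM; congr f.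
    by rewrite mulrDr mulrC [u^-1 * (_ * _)]mulrCA expr2 mulKr // (mulrC n) (mulrC m).
  rewrite !split_inv // rmorphM /= conj_char_unit ?unitrV // invrK fM.
  rewrite (_ : m * b ^+ 2 + _ = k); last by ring.
  rewrite (_ : m * a ^+ 2 + _ = k + m * (a ^+ 2 - b ^+ 2)); last by ring.
  by ring.
transitivity (\sum_(a : R | a \is a GRing.unit)
    (\sum_(y : R | y ^+ 2 == 1) f y) * (#|R|%:R * N)); last first.
  by rewrite sumr_const -/N -[LHS]mulr_natr -/N; ring.
(* With [b = a * y], the condition on squares becomes [y ^+ 2 = 1], which already forces [y] to be a
   unit. *)
apply: eq_bigr => a Ua; rewrite (reindex_inj (mulrI Ua)) /= mulr_suml.
rewrite big_mkcond [RHS]big_mkcond; apply: eq_bigr => y _ /=.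
rewrite unitrMr // mulKr // exprMn -{1}[a ^+ 2]mulr1 (inj_eq (mulrI _)) ?unitrX //.
rewrite eq_sym; have [y2|] := eqVneq (y ^+ 2) 1; last by rewrite mul0r mulr0 if_same.
by rewrite mul1r (_ : y \is a GRing.unit) //; apply/unitrP; exists y; rewrite -expr2.
Qed.
End FiniteRingCharacter.

(** * Dirichlet characters on the integers: products and primitivity *)

Section DirichletCharacters.
Variable C : numClosedFieldType.
Implicit Types (q d : nat) (chi psi : int -> C).

Lemma coprimez_primes q (c : int) : (0 < q)%N ->
  coprimez c q%:Z = all (fun p => ~~ (p %| `|c|)%N) (primes q).
Proof.
move=> q0; rewrite coprimezE absz_nat; apply/idP/allP => [co p|H].
  rewrite mem_primes => /and3P[pp _ pq]; apply/negP => pc.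
  by move: (dvdn_gcd p `|c| q); rewrite pc pq (eqP co) dvdn1 => /eqP pE; rewrite pE in pp.
apply/negPn/negP => nco.
have g1 : (1 < gcdn `|c| q)%N by rewrite ltn_neqAle eq_sym nco gcdn_gt0 q0 orbT.
have /H/negP[] : pdiv (gcdn `|c| q) \in primes q.
  by rewrite mem_primes pdiv_prime // q0 (dvdn_trans (pdiv_dvd _)) ?dvdn_gcdr.
by rewrite (dvdn_trans (pdiv_dvd _)) ?dvdn_gcdl.
Qed.

Lemma dirichlet_eq_mod q chi (m n : int) :
  dirichlet_character q chi -> (q %| m - n)%Z -> chi m = chi n.
Proof.
case=> chiD _ _ _.
have chiDn k l : chi (l + k%:Z * q%:Z) = chi l.
  elim: k => [|k IH]; first by rewrite mul0r addr0.
  by rewrite -addn1 PoszD mulrDl mul1r addrA chiD.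
move=> /dvdzP[[] k kE].
  by rewrite -(chiDn k n) -kE addrC subrK.
by rewrite -(chiDn k.+1 m) -[m](subrK n) kE NegzE; congr chi; ring.
Qed.

Lemma dirichlet_prod q d (chi_ : nat -> int -> C) (s : seq nat) :
  (0 < d)%N -> primes d =i s -> {subset s <= primes q} ->
  (forall p, p \in s -> dirichlet_character (p ^ logn p q)%N (chi_ p)) ->
  (forall p, p \in s -> (p ^ logn p q %| d)%N) ->
  dirichlet_character d (fun n => \prod_(p <- s) chi_ p n).
Proof.
move=> d0 pd sub dir dvd; split.
- move=> n; rewrite big_seq_cond [RHS]big_seq_cond.
  apply: eq_bigr => p /andP[ps _]; apply: (dirichlet_eq_mod (dir p ps)).
  by rewrite addrC addKr dvdzE !absz_nat dvd.
- by rewrite big_seq_cond big1 // => p /andP[ps _]; case: (dir p ps).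
- move=> m n; rewrite -big_split big_seq_cond [RHS]big_seq_cond.
  by apply: eq_bigr => p /andP[ps _]; case: (dir p ps).
- move=> n; rewrite coprimez_primes // prodf_seq_neq0.
  rewrite (eq_all_r pd); apply: eq_in_all => p ps /=.
  case: (dir p ps) => _ _ _ ->.
  have := sub p ps; have := sub p ps.
  rewrite -{1}logn_gt0 mem_primes => lp /andP[pp _].
  by rewrite coprimezE absz_nat coprime_sym coprime_pexpl // prime_coprime.
Qed.

(** If there were no such [c], the values of [chi] at integers coprime to [q] would depend only on
    residues modulo [d], and [chi] would descend to a character [psi] modulo [d]. *)
Lemma primitive_witness q chi d : (0 < q)%N ->
  primitive_character q chi -> (d %| q)%N -> (d < q)%N ->
  exists c : int, [/\ coprimez c q%:Z, (d %| c - 1)%Z & chi c != 1].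
Proof.
move=> q0 [dir prim] dq ltdq.
have d0 : (0 < d)%N by apply: dvdn_gt0 dq.
have [//|noc] := pselect (exists c : int,
  [/\ coprimez c q%:Z, (d %| c - 1)%Z & chi c != 1]).
exfalso; apply: (prim d dq ltdq).
have [_ chi1 chiM chi0] := dir.
have chi_eq (a b : int) : coprimez a q%:Z -> coprimez b q%:Z ->
    (d %| a - b)%Z -> chi a = chi b.
  (* [u] inverts [b] modulo [q], so [u * a] is 1 modulo [d] and cannot be a witness. *)
  move=> ca cb dab; have /coprimezP[[u v] /= uv] := cb.
  have cu : coprimez u q%:Z by apply/coprimezP; exists (b, v); rewrite /= mulrC.
  have ub : chi (u * b) = 1.
    rewrite -chi1; apply: (dirichlet_eq_mod dir); rewrite -uv opprD addrA subrr add0r.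
    by rewrite -mulNr dvdz_mull.
  have ua : chi (u * a) = 1.
    apply/eqP/negPn/negP => ua; apply: noc; exists (u * a); split=> //.
      by rewrite coprimezMl cu.
    rewrite -uv (_ : u * a - _ = u * (a - b) - v * q%:Z); last by ring.
    by rewrite rpredB // ?dvdz_mull // dvdzE.
  have u0 : chi u != 0 by rewrite chi0.
  by apply: (mulfI u0); rewrite -!chiM ua ub.
(* For [n] coprime to [d], each prime of [q] divides exactly one of [n] and [d * P n]; hence their
   sum is coprime to [q]. *)
pose P (n : int) := (\prod_(p <- primes q | ~~ (p %| `|n|)) p)%N.
have dvdP n p : p \in primes q -> (p %| P n)%N = ~~ (p %| `|n|)%N.
  move=> pq; have := pq; rewrite mem_primes => /and3P[pp _ _].
  rewrite /P Euclid_dvd_prod // big_has_cond.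
  apply/hasP/idP => [[r rq /andP[nr pr]]|pn]; last by exists p; rewrite //= pn dvdnn.
  move: rq; rewrite mem_primes => /andP[rp _].
  by move: pr nr; rewrite dvdn_prime2 // => /eqP ->.
pose lift (n : int) : int := n + d%:Z * (P n)%:Z.
have lift_mod n : (d %| lift n - n)%Z by rewrite /lift addrC addKr dvdz_mulr.
have lift_coprime n : coprimez n d%:Z -> coprimez (lift n) q%:Z.
  rewrite (coprimez_primes n d0) (coprimez_primes (lift n) q0) => /allP cnd.
  apply/allP => p pq; have := pq; rewrite mem_primes => /and3P[pp _ _].
  have -> : (p %| `|lift n|)%N = (p%:Z %| lift n)%Z by rewrite dvdzE.
  have nE : (p %| `|n|)%N = (p%:Z %| n)%Z by rewrite dvdzE.
  have PE : (p%:Z %| d%:Z * (P n)%:Z)%Z = (p %| d)%N || ~~ (p %| `|n|)%N.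
    by rewrite dvdzE abszM !absz_nat Euclid_dvdM // dvdP.
  rewrite /lift; have [pn|pn] := boolP (p %| `|n|)%N; last first.
    by rewrite rpredDr ?PE ?pn ?orbT // -nE.
  rewrite rpredDl -?nE // PE pn orbF.
  apply/negP => pd; suff : p \in primes d by move/cnd; rewrite pn.
  by rewrite mem_primes pp d0.
pose psi (n : int) : C := if coprimez n d%:Z then chi (lift n) else 0.
have psiE (n c : int) : coprimez n d%:Z -> coprimez c q%:Z ->
    (d %| c - n)%Z -> psi n = chi c.
  move=> cn cc dc; rewrite /psi cn; apply: chi_eq => //; first exact: lift_coprime.
  rewrite (_ : lift n - c = (lift n - n) - (c - n)); last by ring.
  by rewrite rpredB.
have co1 k : coprimez 1 k by rewrite coprimezE coprime1n.
exists psi; split; last first.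
  move=> n cn; rewrite (psiE n n) ?subrr ?dvdz0 //.
  exact: coprimez_dvdr cn.
have coD n : coprimez (n + d%:Z) d%:Z = coprimez n d%:Z.
  by rewrite /coprimez ![gcdz _ d%:Z]gcdzC addrC gcdzDl.
split.
- move=> n; rewrite [RHS]/psi; case: ifP => [cn|cn]; last by rewrite /psi coD cn.
  apply: psiE; rewrite ?coD ?lift_coprime //.
  rewrite (_ : _ - _ = (lift n - n) - d%:Z); last by ring.
  by rewrite rpredB // dvdzE.
- by rewrite (psiE 1 1) ?subrr ?dvdz0.
- move=> m n.
  have [cm|cm] := boolP (coprimez m d%:Z); last first.
    by rewrite /psi coprimezMl (negPf cm) mul0r.
  have [cn|cn] := boolP (coprimez n d%:Z); last first.
    by rewrite /psi coprimezMl (negPf cn) andbF mulr0.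
  rewrite [psi m]/psi [psi n]/psi cm cn -chiM; apply: psiE.
  + by rewrite coprimezMl cm.
  + by rewrite coprimezMl !lift_coprime.
  rewrite (_ : _ - _ = (lift m - m) * lift n + m * (lift n - n)); last by ring.
  apply: rpredD; [exact: dvdz_mulr|exact: dvdz_mull].
- move=> n; rewrite /psi; case: ifP => cn; last by rewrite eqxx.
  by rewrite chi0 lift_coprime.
Qed.

End DirichletCharacters.

(** * Transfer to ['Z_q], with [q] at least 2 so that this ring is the integers modulo [q] *)

Section ResidueRing.
Variables (C : numClosedFieldType) (n : nat) (chi : int -> C).
Let q := n.+2.
Hypothesis chi_prim : primitive_character q chi.
Let chi_dir : dirichlet_character q chi := proj1 chi_prim.
Let f (x : 'Z_q) : C := chi (x : nat)%:Z.

Lemma natZq_eq0 : (q%:~R : 'Z_q) = 0.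
Proof. by rewrite -[q%:~R]/(q%:R) pchar_Zp. Qed.

Lemma char_residue (z : int) : chi z = f z%:~R.
Proof.
have f_nat (k : nat) : chi k%:Z = f k%:R.
  rewrite /f val_Zp_nat //; apply: (dirichlet_eq_mod chi_dir).
  by rewrite {1}(divn_eq k q) PoszD addrK PoszM dvdz_mull.
have /gez0_abs zE : 0 <= (z %% q)%Z by rewrite modz_ge0.
have -> : chi z = chi `|(z %% q)%Z|%N%:Z.
  apply: (dirichlet_eq_mod chi_dir).
  by rewrite zE {1}(divz_eq z q) addrK dvdz_mull.
rewrite f_nat; congr f; rewrite -[LHS]/(`|(z %% q)%Z|%N%:Z%:~R) zE.
rewrite [in RHS](divz_eq z q) [RHS]intrD [X in _ = X + _]intrM.
by rewrite natZq_eq0 mulr0 add0r.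
Qed.

Lemma unit_residue (x : 'Z_q) : (x \is a GRing.unit) = coprime x q.
Proof. by rewrite -{1}[x]natr_Zp unitZpE // coprime_sym. Qed.

Lemma residue_char1 : f 1 = 1.
Proof. by rewrite -[X in f X]/(1%:~R) -char_residue; case: chi_dir. Qed.

Lemma residue_charM : {morph f : x y / x * y}.
Proof.
move=> x y; case: chi_dir => _ _ chiM _.
by rewrite -[f x * f y]chiM (char_residue (_ * _)) intrM -!pmulrn !natr_Zp.
Qed.

Lemma residue_char_neq0 x : (f x != 0) = (x \is a GRing.unit).
Proof. by case: chi_dir => _ _ _ chi0; rewrite /f chi0 coprimezE unit_residue. Qed.

(** The gcd of [d] and [q] is a proper divisor of [q], and by Bezout each of its multiples is a
    multiple of [d] in ['Z_q]; the integer witness for the gcd therefore has the form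
    [1 + d * e]. *)
Lemma residue_char_primitive : ring_primitive f.
Proof.
move=> d d0; pose g := gcdn d q.
have d_gt0 : (0 < d)%N by rewrite lt0n; apply: contra d0 => /eqP dE; apply/eqP/val_inj.
have gq : (g < q)%N.
  by apply: leq_ltn_trans (ltn_ord d); apply: dvdn_leq => //; apply: dvdn_gcdl.
have [c [cc gc fc]] := primitive_witness (ltn0Sn _) chi_prim (dvdn_gcdr d q) gq.
have [u [v uv]] := Bezoutz (d : nat)%:Z q%:Z.
have [k kE] := dvdzP gc.
have cE : 1 + d * (u * k)%:~R = c%:~R :> 'Z_q.
  rewrite -[c](subrK 1) kE -[(gcdn d q)%:Z]/(gcdz (d : nat)%:Z q%:Z) -uv.
  rewrite !(intrD, intrM) natZq_eq0 -pmulrn natr_Zp.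
  by ring.
exists (u * k)%:~R; rewrite cE -residue_char_neq0 -char_residue.
by split => //; case: chi_dir => _ _ _ ->.
Qed.

Lemma modinv_residue (a : 'Z_q) :
  a \is a GRing.unit -> (modinv q (a : nat)%:Z)%:~R = a^-1.
Proof.
rewrite unit_residue => co; have Ua : a \is a GRing.unit by rewrite unit_residue.
rewrite /modinv; case: egcdzP => u v uv _ /=; apply: (mulIr Ua).
have := congr1 (fun z : int => z%:~R : 'Z_q) uv.
rewrite !(intrD, intrM) natZq_eq0 mulr0 addr0 -pmulrn natr_Zp => ->.
by rewrite mulVr // /gcdz !absz_nat (eqP co).
Qed.

Lemma card_unit_residue : #|[pred u : 'Z_q | u \is a GRing.unit]| = totient q.
Proof.
rewrite totient_count_coprime -sum1_card big_mkord big_mkcond /=.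
by apply: eq_bigr => x _; rewrite unit_residue coprime_sym; case: (coprime _ _).
Qed.

Lemma Ksum_primitive : Ksum q chi =
  q%:R * (totient q)%:R ^+ 2 * \sum_(y < q | y ^ 2 == 1 %[mod q]) chi (y : nat)%:Z.
Proof.
have := sum_sqr_norm_kloosterman residue_char1 residue_charM residue_char_neq0
  residue_char_primitive.
rewrite card_unit_residue card_ord => KE; transitivity (q%:R * (totient q)%:R ^+ 2 *
  \sum_(y : 'Z_q | y ^+ 2 == 1) f y); last first.
  (* Equality in ['Z_q] computes to equality of remainders, so both sums are convertible. *)
  by [].
rewrite -KE; apply: eq_bigr => x _; apply: eq_bigr => y _; congr (`| _ | ^+ 2).
apply: eq_big => [a|a co]; first by rewrite unit_residue.
rewrite char_residue; congr f.
by rewrite intrD !intrM modinv_residue ?unit_residue // -!pmulrn !natr_Zp.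
Qed.

Lemma sum_char_sqrt1_eq0 : (4 %| q)%N ->
  \sum_(y < q | y ^ 2 == 1 %[mod q]) chi (y : nat)%:Z = 0.
Proof.
(* Here [d] is [q / 2]. Both [2 * d = q] and [d * d = q * k] vanish modulo [q], so [c = 1 + d * e]
   squares to 1. *)
case/dvdnP => k qE; pose d : 'Z_q := (2 * k)%:R.
have d0 : d != 0.
  rewrite -(inj_eq val_inj) /d /= val_Zp_nat // modn_small; by lia.
have d2 : d *+ 2 = 0.
  by rewrite -natZq_eq0 -[q%:~R]/(q%:R) /d -mulrnA qE; congr _%:R; lia.
have dd : d * d = 0.
  have -> : d * d = q%:R * k%:R by rewrite /d -!natrM qE; congr _%:R; lia.
  by rewrite -[q%:R]/(q%:~R) natZq_eq0 mul0r.
have [e [Uc fc]] := residue_char_primitive d0; set c := 1 + d * e in Uc fc.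
have c2 : c ^+ 2 = 1.
  have -> : c ^+ 2 = 1 + d *+ 2 * e + d * d * e ^+ 2 by rewrite /c; ring.
  by rewrite d2 dd !mul0r !addr0.
suff /eqP : f c * \sum_(y : 'Z_q | y ^+ 2 == 1) f y = \sum_(y : 'Z_q | y ^+ 2 == 1) f y.
  rewrite -subr_eq0 -{2}[\sum_(_ | _) _]mul1r -mulrBl mulf_eq0 subr_eq0.
  by rewrite (negPf fc) => /eqP.
(* Multiplication by [c] permutes the square roots of 1. *)
rewrite mulr_sumr [RHS](reindex_inj (mulrI Uc)) /=; apply: eq_big => y.
  by rewrite exprMn c2 mul1r.
by rewrite residue_charM.
Qed.

End ResidueRing.

(** * Square roots of 1 modulo odd integers *)

Lemma dvdz_prime_power_sqrt1 (p k : nat) (y : int) : prime p -> odd p ->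
  ((p ^ k)%N %| y ^+ 2 - 1)%Z -> ((p ^ k)%N %| y - 1)%Z || ((p ^ k)%N %| y + 1)%Z.
Proof.
move=> pp podd; rewrite subr_sqr_1 => dvd.
have co (z : int) : ~~ (p %| z)%Z -> coprimez (p ^ k)%N z.
  by move=> pz; rewrite coprimezE absz_nat coprimeXl // prime_coprime // -dvdzE.
(* A factor prime to [p] leaves the whole power to the other one; if [p] divided both, it would
   divide their difference 2. *)
have [py|/co cy] := boolP (p %| y - 1)%Z; last by rewrite -(Gauss_dvdzr (y + 1) cy) dvd orbT.
have [py'|/co cy] := boolP (p %| y + 1)%Z; last by rewrite -(Gauss_dvdzl (y - 1) cy) dvd.
have := rpredB py' py; rewrite (_ : y + 1 - (y - 1) = 2%N); last by ring.
by rewrite dvdzE !absz_nat dvdn_prime2 // => /eqP p2; rewrite p2 in podd.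
Qed.

Lemma dvdz_sqrt1 (d q y : nat) :
  y ^ 2 == 1 %[mod q] -> (d %| q)%N -> (d %| y%:Z ^+ 2 - 1)%Z.
Proof.
move=> y2 dq; have : (q %| y%:Z ^+ 2 - 1)%Z.
  by rewrite -eqz_mod_dvd expr2 -PoszM mulnn !modz_nat.
by apply: dvdz_trans; rewrite dvdzE !absz_nat.
Qed.

(** A root is 1 or -1 modulo each prime power exactly dividing [q]. The vector [g] of these signs
    determines it modulo every such power, hence modulo [q]. *)
Lemma card_sqrt1_mod q : odd q ->
  (#|[set y : 'I_q | y ^ 2 == 1 %[mod q]]| <= 2 ^ omega q)%N.
Proof.
move=> oddq; have q0 : (0 < q)%N by case: q oddq.
pose g (y : 'I_q) : (omega q).-tuple bool :=
  map_tuple (fun p : nat => ((p ^ logn p q)%N %| y%:Z - 1)%Z) (in_tuple (primes q)).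
rewrite -(card_in_imset (f := g)).
  by apply: leq_trans (max_card _) _; rewrite card_tuple card_bool.
have sqrt1 (y : 'I_q) (p : nat) : p \in primes q -> y ^ 2 == 1 %[mod q] ->
    ~~ ((p ^ logn p q)%N %| y%:Z - 1)%Z -> ((p ^ logn p q)%N %| y%:Z + 1)%Z.
  rewrite mem_primes => /and3P[pp _ pq] y2 /negPf ny.
  have := @dvdz_prime_power_sqrt1 p (logn p q) y pp (dvdn_odd pq oddq).
  rewrite ny; apply.
  exact: dvdz_sqrt1 y2 (pfactor_dvdnn _ _).
move=> y z; rewrite !inE => y2 z2 /(congr1 val) /= /eq_in_map yz.
suff : (q %| y%:Z - z%:Z)%Z.
  rewrite -eqz_mod_dvd !modz_nat eqz_nat !modn_small // => /eqP.
  exact: val_inj.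
rewrite dvdzE absz_nat; apply/dvdn_partP => // p pq.
have {}pq : p \in primes q by [].
have -> : (q`_p %| `|(y%:Z - z%:Z)%R|)%N = ((p ^ logn p q)%N %| y%:Z - z%:Z)%Z by rewrite dvdzE p_part.
have := yz p pq; have [y1|/(sqrt1 _ _ pq y2) y1] := boolP (_ %| y%:Z - 1)%Z.
  move/esym => z1; rewrite (_ : y%:Z - z%:Z = (y%:Z - 1) - (z%:Z - 1)); last by ring.
  exact: rpredB.
move/esym/negbT/(sqrt1 _ _ pq z2) => z1.
rewrite (_ : y%:Z - z%:Z = (y%:Z + 1) - (z%:Z + 1)); last by ring.
exact: rpredB.
Qed.

(** * Consequences of complete evenness *)

Section CompletelyEven.
Variables (C : numClosedFieldType) (q : nat) (chi : int -> C).
Hypotheses (q_gt0 : (0 < q)%N) (chi_even : completely_even q chi).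

Lemma completely_even_odd_modulus :
  primitive_character q chi -> ~~ (8 %| q)%N -> odd q.
Proof.
case=> dir prim q8; apply/negPn/negP => q2.
have [chi_ [dir_ chiE even_]] := chi_even.
have p2 : 2 \in primes q by rewrite mem_primes q_gt0 dvdn2.
have L0 : (0 < logn 2 q)%N by rewrite logn_gt0.
have L4 : (2 ^ logn 2 q %| 4)%N.
  rewrite (@dvdn_Pexp2l 2 _ 2) // leqNgt; apply: contra q8.
  by rewrite -(@pfactor_dvdn 2 3).
have chi2 (n : int) : coprimez n q%:Z -> chi_ 2 n = 1.
  rewrite coprimez_primes // => /allP/(_ _ p2); rewrite dvdn2 negbK => nodd.
  have [_ one _ _] := dir_ 2 p2.
  (* The modulus of [chi_ 2] divides 4, and an odd [n] is 1 or -1 modulo 4; evenness gives the value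
     1 in both cases. *)
  have /orP[n1|n1] : (4 %| n - 1)%Z || (4 %| n + 1)%Z by lia.
    rewrite -one; apply: (dirichlet_eq_mod (dir_ 2 p2)).
    exact: dvdz_trans n1.
  rewrite -(even_ 2 p2); apply: (dirichlet_eq_mod (dir_ 2 p2)).
  by rewrite opprK; apply: dvdz_trans n1.
pose s := [seq p <- primes q | p != 2]; pose d := (q`_(2%N^'))%N.
have d_dvd : (d %| q)%N by apply: dvdn_part.
(* [d] is the odd part of [q], and the removed 2-part exceeds 1. *)
have ltdq : (d < q)%N.
  rewrite -[X in (_ < X)%N](partnC 2%N q_gt0) -/d p_part -[X in (X < _)%N]mul1n.
  by rewrite ltn_pmul2r ?part_gt0 // -(expn0 2) ltn_exp2l.
have sE p : p \in s = (p \in primes q) && (p != 2) by rewrite mem_filter andbC.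
apply: (prim d d_dvd ltdq); exists (fun n => \prod_(p <- s) chi_ p n); split.
  apply: (@dirichlet_prod _ q).
  - exact: part_gt0.
  - by move=> p; rewrite primes_part.
  - by move=> p; rewrite sE => /andP[].
  - by move=> p; rewrite sE => /andP[/dir_].
  move=> p; rewrite sE => /andP[pq pn2].
  rewrite -p_part; apply: sub_in_partn => r _.
  by rewrite !inE => /eqP ->.
move=> n cn; rewrite chiE /s big_filter (bigD1_seq 2) ?primes_uniq //=.
by rewrite chi2 // mul1r.
Qed.

Lemma completely_even_sqrt1 (y : nat) :
  odd q -> y ^ 2 == 1 %[mod q] -> chi y%:Z = 1.
Proof.
move=> oddq y2; have [chi_ [dir_ -> even_]] := chi_even.
rewrite big_seq big1 // => p pq; have := pq; rewrite mem_primes => /and3P[pp _ p_dvd].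
have [_ one _ _] := dir_ p pq.
have /(dvdz_prime_power_sqrt1 pp (dvdn_odd p_dvd oddq))/orP[y1|y1] :
    ((p ^ logn p q)%N %| y%:Z ^+ 2 - 1)%Z.
- exact: dvdz_sqrt1 y2 (pfactor_dvdnn _ _).
- by rewrite -one; apply: (dirichlet_eq_mod (dir_ p pq)).
by rewrite -(even_ p pq); apply: (dirichlet_eq_mod (dir_ p pq)); rewrite opprK.
Qed.

End CompletelyEven.

Local Open Scope complex_scope.

Theorem theorem1 (R : realType) (q : nat) (hq : (3 <= q)%N)
    (chi : int -> R[i])
    (chi_prim : primitive_character q chi)
    (chi_even : completely_even q chi) :
  [/\ Ksum q chi =
        q%:R * (totient q)%:R ^+ 2 *
          \sum_(y < q | y ^ 2 == 1 %[mod q]) chi (y : nat)%:Z,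
      (8 %| q)%N -> Ksum q chi = 0
    & ~~ (8 %| q)%N ->
        q%:R * (totient q)%:R ^+ 2 <= Ksum q chi
          <= q%:R * (totient q)%:R ^+ 2 * 2%:R ^+ omega q].
Proof.
have q0 : (0 < q)%N by apply: leq_trans hq.
have KE : Ksum q chi = q%:R * (totient q)%:R ^+ 2 *
    \sum_(y < q | y ^ 2 == 1 %[mod q]) chi (y : nat)%:Z.
  by case: q hq chi_prim {chi_even q0} => [|[|n]] // _; apply: Ksum_primitive.
split=> // [q8|q8]; rewrite KE.
  have q4 : (4 %| q)%N by apply: dvdn_trans q8.
  suff -> : \sum_(y < q | y ^ 2 == 1 %[mod q]) chi (y : nat)%:Z = 0 by rewrite mulr0.
  by case: q hq chi_prim q4 {chi_even q0 KE q8} => [|[|n]] // _; apply: sum_char_sqrt1_eq0.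
have oddq := completely_even_odd_modulus q0 chi_even chi_prim q8.
(* Every term is 1, so the sum is the number [N] of square roots of 1; the residue 1 itself gives
   the lower bound. *)
rewrite (eq_bigr (fun=> 1)) => [|y]; last exact: completely_even_sqrt1.
rewrite sumr_const; set N := #|_|.
have N_le : (N <= 2 ^ omega q)%N.
  by apply: leq_trans (card_sqrt1_mod oddq); rewrite /N cardsE.
have N_gt0 : (0 < N)%N.
  apply/card_gt0P; exists (Ordinal (leq_trans (isT : 1 < 3)%N hq)).
  exact: eqxx.
have A0 : 0 <= q%:R * (totient q)%:R ^+ 2 :> R[i] by rewrite mulr_ge0 ?exprn_ge0 ?ler0n.
by rewrite ler_peMr ?ler1n //= ler_wpM2l // -natrX ler_nat.
Qed.
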